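(* Let $\mu$ be an indeterminate and let $r\ge0$ and $n>2r$ be integers. Define, for positive integers $p$, \[ R_{2r,0}(2p)=\frac{(\mu+2p+4r)_{p-r}\left(\frac{\mu}{2}+2p+r+\frac12\right)_{p-r-1}}{(p-r)_{p-r}\left(\frac{\mu}{2}+p+2r+\frac12\right)_{p-r-1}},\qquad R_{2r,0}(2p-1)=\frac{(\mu+2p+4r-2)_{p-r-1}\left(\frac{\mu}{2}+2p+r-\frac12\right)_{p-r}}{(p-r)_{p-r}\left(\frac{\mu}{2}+p+2r-\frac12\right)_{p-r-1}}. \] Then \[ D_{2r,0}(n)=2\cdot\prod_{i=2r+1}^{n-1}R_{2r,0}(i). \] Consequently $R_{2r,0}(m)=D_{2r,0}(m+1)/D_{2r,0}(m)$ for all integers $m>2r$.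
   Context: $\mu$ is an indeterminate and all quantities lie in $\mathbb{Q}(\mu)$. For integers $s,t$ and $n\ge1$, $D_{s,t}(n)$ denotes the $n\times n$ determinant $\det\bigl(\delta_{i,j}+\binom{\mu+i+j-2}{j}\bigr)$ with row index $i$ running over $s\le i<s+n$ and column index $j$ over $t\le j<t+n$; here $\delta_{i,j}$ is the Kronecker delta and $\binom{x}{j}=x(x-1)\cdots(x-j+1)/j!$ for integers $j\ge0$, $\binom{x}{j}=0$ for $j<0$. The Pochhammer symbol is $(x)_k=x(x+1)\cdots(x+k-1)$ for $k>0$, $(x)_0=1$, and $(x)_k=1/(x+k)_{-k}$ for $k<0$. An empty product equals $1$. *)

(* Defs.v *)
From mathcomp Require Import all_boot all_order all_algebra.

Set Implicit Arguments.
Unset Strict Implicit.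
Unset Printing Implicit Defensive.

Import GRing.Theory.
Local Open Scope ring_scope.

Notation Qmu := {fraction {poly rat}}.

Definition mu : Qmu := tofrac 'X.

Definition binom (F : fieldType) (x : F) (j : int) : F :=
  match j with
  | Posz k => (\prod_(i < k) (x - i%:R)) / (k`!)%:R
  | Negz _ => 0
  end.

(* Negz k is -(k+1), so the second branch is 1 / (x + m)_{-m} for m < 0. *)
Definition pochhammer (F : fieldType) (x : F) (m : int) : F :=
  match m with
  | Posz k => \prod_(i < k) (x + i%:R)
  | Negz k => (\prod_(i < k.+1) (x + (Negz k)%:~R + i%:R))^-1
  end.

(* The ordinals i, j < n are offsets: the row index is s + i and the column
   index is t + j. *)
Definition D (s t : int) (n : nat) : Qmu :=
  \det (\matrix_(i < n, j < n)
    ((s + i%:Z == t + j%:Z)%:R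
     + binom (mu + (s + i%:Z)%:~R + (t + j%:Z)%:~R - 2%:R) (t + j%:Z))).

Definition R_even (r p : nat) : Qmu :=
  (pochhammer (mu + (2 * p)%:R + (4 * r)%:R) (p%:Z - r%:Z)
   * pochhammer (mu / 2%:R + (2 * p)%:R + r%:R + 2%:R^-1) (p%:Z - r%:Z - 1))
  / (pochhammer (p%:R - r%:R) (p%:Z - r%:Z)
   * pochhammer (mu / 2%:R + p%:R + (2 * r)%:R + 2%:R^-1) (p%:Z - r%:Z - 1)).

Definition R_odd (r p : nat) : Qmu :=
  (pochhammer (mu + (2 * p)%:R + (4 * r)%:R - 2%:R) (p%:Z - r%:Z - 1)
   * pochhammer (mu / 2%:R + (2 * p)%:R + r%:R - 2%:R^-1) (p%:Z - r%:Z))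
  / (pochhammer (p%:R - r%:R) (p%:Z - r%:Z)
   * pochhammer (mu / 2%:R + p%:R + (2 * r)%:R - 2%:R^-1) (p%:Z - r%:Z - 1)).

(* R r i is R_{2r,0}(i), for i > 0. Both i = 2p and i = 2p - 1 have
   uphalf i = p. The value at i = 0 is junk. *)
Definition R (r i : nat) : Qmu :=
  if odd i then R_odd r (uphalf i) else R_even r (uphalf i).

(* Main.v *)
Require Import Defs.
From mathcomp Require Import all_boot all_order all_fingroup all_algebra.
From mathcomp Require Import ring zify.

Set Implicit Arguments.
Unset Strict Implicit.
Unset Printing Implicit Defensive.

Import Order.TTheory GRing.Theory Num.Theory.
Local Open Scope ring_scope.

(* Write nu = mu - 1 and (c choose+ m) = (c)_m / m! = [x^m] (1 - x)^(-c), so that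
   the entry in row s + i and column j is delta + (nu + s + i choose+ j). A
   combination of rows is encoded by a polynomial p, and the columns are
   combined with the weights (g choose+ N - j). By Vandermonde the result is
   Phi_{g, N - s}(p) + Psi_{nu + s + g, N}(p), and both functionals transform
   simply when p is multiplied by X or by X - 1.
   - The rows (X - 1)^k, then X^k (X - 1)^s, and g = s make the matrix block
     triangular: D_{s,0}(n) with s even is D_{0,0}(n - s) with nu replaced by
     nu + 3s.
   - For s = 0 and h = nu / 2 the rows (X (X - 1))^k and
     (X - 1/2) (X (X - 1))^k, with g about - h - N / 2, give a matrix whose
     entries vanish when the row and column indices have different parities.
   - The even and odd blocks are, up to scaling rows and columns, instances of
     a two-parameter determinant of Krattenthaler, which is evaluated by
     Dodgson condensation.
   The ratio of two consecutive determinants is then a single factor of the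
   resulting products. *)

(** * Schur complements and Dodgson condensation *)

Section Dodgson.

Variable F : fieldType.
Implicit Type M : nat -> nat -> F.

(** Splitting off a unitriangular left factor clears the block [B] and leaves a block lower
    triangular matrix. *)
Lemma det_schur (n1 n2 : nat) (A : 'M[F]_n1) (B : 'M_(n1, n2)) (C : 'M_(n2, n1))
    (E : 'M_n2) :
  E \in unitmx ->
  \det (block_mx A B C E) = \det E * \det (A - B *m invmx E *m C).
Proof.
move=> uE.
have -> : block_mx A B C E =
    block_mx 1%:M (B *m invmx E) 0 1%:M *m block_mx (A - B *m invmx E *m C) 0 C E.
  by rewrite mulmx_block !mul1mx !mul0mx ?mulmx0 !add0r subrK mulmxKV.
by rewrite det_mulmx det_ublock det_lblock !det1 !mul1r mulrC.
Qed.

Lemma det_mx2 (A : 'M[F]_2) :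
  \det A = A ord0 ord0 * A ord_max ord_max - A ord0 ord_max * A ord_max ord0.
Proof.
have l01 : lift ord0 0 = ord_max :> 'I_2 by apply: val_inj.
have l10 : lift ord_max 0 = ord0 :> 'I_2 by apply: val_inj.
rewrite (expand_det_row _ ord0) big_ord_recl big_ord1 l01 /cofactor !det_mx11 !mxE.
rewrite l01 l10 /=.
by rewrite add0n expr0 expr1 mul1r mulN1r mulrN.
Qed.

Lemma det_reindex (n : nat) (s t : 'S_n) (A : 'M[F]_n) :
  \det (\matrix_(i, j) A (s i) (t j)) = (-1) ^+ s * (-1) ^+ t * \det A.
Proof.
have -> : \matrix_(i, j) A (s i) (t j) = row_perm s (col_perm t A).
  by apply/matrixP=> i j; rewrite !mxE.
rewrite row_permE col_permE !det_mulmx !det_perm odd_permV.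
by rewrite -mulrA; congr (_ * _); rewrite mulrC.
Qed.

(** Entries are functions of natural numbers, so that a contiguous minor is again a [window_det], of
    a shifted function. *)
Definition window_det (n : nat) M : F := \det (\matrix_(i < n, j < n) M i j).

Lemma eq_window_det (n : nat) (M M' : nat -> nat -> F) :
  (forall i j, (i < n)%N -> (j < n)%N -> M i j = M' i j) ->
  window_det n M = window_det n M'.
Proof. by move=> eqM; congr determinant; apply/matrixP=> i j; rewrite !mxE eqM. Qed.

(* Take Schur complements with respect to the central n x n block; the
   permutations bring each minor to the form in which that block comes last. *)
Lemma dodgson (n : nat) M :
  window_det n (fun i j => M i.+1 j.+1) != 0 ->
  window_det n.+2 M * window_det n (fun i j => M i.+1 j.+1) =
    window_det n.+1 M * window_det n.+1 (fun i j => M i.+1 j.+1)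
    - window_det n.+1 (fun i j => M i.+1 j) * window_det n.+1 (fun i j => M i j.+1).
Proof.
set C := \matrix_(i < n, j < n) M i.+1 j.+1.
have -> : window_det n (fun i j => M i.+1 j.+1) = \det C by [].
move=> C0; have uC : C \in unitmx by rewrite unitmxE unitfE.
pose u a : 'rV[F]_n := \row_j M a j.+1.
pose v b : 'cV[F]_n := \col_i M i.+1 b.
(* Schur complement of the centre [C] bordered by row [a] and column [b]. All the determinants of
   the identity are expressed through [\det C] and these scalars. *)
pose S a b := M a b - (u a *m invmx C *m v b) 0 0.
pose rho a i := if i is 0 then a else i.
have det_bord a b : \det (\matrix_(i < n.+1, j < n.+1) M (rho a i) (rho b j)) = \det C * S a b.
  transitivity (\det (block_mx ((M a b)%:M : 'M_1) (u a) (v b) C)).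
    congr determinant; apply/matrixP => i j.
    by rewrite !mxE; do 2![case: splitP => ? ->; rewrite !mxE]; rewrite ?ord1 ?eqxx ?mulr1n.
  by rewrite (det_schur _ _ _ uC) det_mx11 mxE [in X in X + _]mxE [X in _ + X]mxE eqxx mulr1n.
(* This permutation reorders 1, ..., n + 1 as n + 1, 1, ..., n. Its sign occurs once in each of the
   two mixed minors and cancels in their product. *)
pose cyc : 'S_n.+1 := lift_perm ord0 ord_max 1%g.
have cycE (i : 'I_n.+1) : (cyc i).+1 = rho n.+1 i.
  case: (unliftP ord0 i) => [k|] ->; first by rewrite lift_perm_lift perm1 lift_max lift0.
  by rewrite lift_perm_id.
have sgnK (s : bool) : (-1) ^+ s * (-1) ^+ s = 1 :> F by rewrite -expr2 sqrr_sign.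
have sgn1 : (-1) ^+ (1%g : 'S_n.+1) = 1 :> F by rewrite odd_perm1.
have ul : window_det n.+1 M = \det C * S 0 0.
  rewrite -det_bord; congr determinant; apply/matrixP => i j; rewrite !mxE.
  by case: (nat_of_ord i) (nat_of_ord j) => [|?] [|?].
have lr : window_det n.+1 (fun i j => M i.+1 j.+1) = \det C * S n.+1 n.+1.
  transitivity ((-1) ^+ cyc * (-1) ^+ cyc * window_det n.+1 (fun i j => M i.+1 j.+1)).
    by rewrite sgnK mul1r.
  rewrite -det_bord -det_reindex.
  by congr determinant; apply/matrixP => i j; rewrite !mxE !cycE.
have ll : (-1) ^+ cyc * window_det n.+1 (fun i j => M i.+1 j) = \det C * S n.+1 0.
  rewrite -[_ ^+ cyc]mulr1 -[X in _ * X * _]sgn1.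
  rewrite -det_bord -det_reindex; congr determinant; apply/matrixP => i j.
  by rewrite !mxE cycE perm1; case: (nat_of_ord j).
have ur : (-1) ^+ cyc * window_det n.+1 (fun i j => M i j.+1) = \det C * S 0 n.+1.
  rewrite -[_ ^+ cyc]mul1r -[X in X * _ * _]sgn1.
  rewrite -det_bord -det_reindex; congr determinant; apply/matrixP => i j.
  by rewrite !mxE cycE perm1; case: (nat_of_ord i).
pose tau : 'S_n.+2 := lift_perm ord0 ord0 cyc.
have tauE (i : 'I_n.+2) : tau i = (if nat_of_ord i is i'.+1 then rho n.+1 i' else 0)%N :> nat.
  case: (unliftP ord0 i) => [k|] ->; last by rewrite lift_perm_id.
  by rewrite lift_perm_lift !lift0 cycE.
(* For i < 2 the index [i * n.+1] runs over the two corners 0 and n + 1. *)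
pose A : 'M[F]_2 := \matrix_(i < 2, j < 2) M (i * n.+1)%N (j * n.+1)%N.
pose B : 'M[F]_(2, n) := \matrix_(i < 2, j < n) M (i * n.+1)%N j.+1.
pose E : 'M[F]_(n, 2) := \matrix_(i < n, j < 2) M i.+1 (j * n.+1)%N.
have full : window_det n.+2 M = \det C * (S 0 0 * S n.+1 n.+1 - S 0 n.+1 * S n.+1 0).
  transitivity (\det (block_mx A B E C)).
    transitivity ((-1) ^+ tau * (-1) ^+ tau * window_det n.+2 M); first by rewrite sgnK mul1r.
    rewrite -det_reindex.
    congr determinant; apply/matrixP => i j; rewrite !mxE !tauE.
    by do 2![case: splitP => -[[|[|?]] ?] //= ->; rewrite !mxE /=]; rewrite ?mul1n ?add1n.
  have SE i j : (A - B *m invmx C *m E) i j = S (i * n.+1)%N (j * n.+1)%N.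
    rewrite /S 2!mxE [X in _ + X]mxE; congr (_ - _).
    rewrite mxE [RHS]mxE; apply: eq_bigr => k _; congr (_ * _); last by rewrite !mxE.
    by rewrite mxE [RHS]mxE; apply: eq_bigr => l _; rewrite [B _ _]mxE [u _ _ _]mxE.
  rewrite [LHS](det_schur A B E uC) det_mx2; congr (_ * _).
  by rewrite !SE /= !mul0n !mul1n.
have -> : window_det n.+1 (fun i j => M i.+1 j) * window_det n.+1 (fun i j => M i j.+1) =
    \det C * S n.+1 0 * (\det C * S 0 n.+1).
  by rewrite -ll -ur mulrACA sgnK mul1r.
by rewrite full ul lr; ring.
Qed.

End Dodgson.

(** * Pochhammer symbols of integer length and reciprocal factorials *)

Section Pochhammer.

Variable F : fieldType.
Implicit Types (x : F) (m n : int) (k : nat).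

(** Genericity: no factor of a Pochhammer symbol based at [x] vanishes, whatever the sign of the
    length. *)
Definition nonint x := forall m, x + m%:~R != 0.

Lemma nonintD x m : nonint x -> nonint (x + m%:~R).
Proof. by move=> hx n; rewrite -addrA -intrD. Qed.

Lemma pochhammer0 x : pochhammer x 0 = 1.
Proof. by rewrite /= big_ord0. Qed.

Lemma pochhammerSr x k : pochhammer x k.+1%:Z = pochhammer x k%:Z * (x + k%:R).
Proof. by rewrite /= big_ord_recr. Qed.

Lemma pochhammerSl x k : pochhammer x k.+1%:Z = x * pochhammer (x + 1) k%:Z.
Proof.
rewrite /= big_ord_recl addr0; congr (_ * _); apply: eq_bigr => i _.
by rewrite lift0 -natr1; ring.
Qed.

Lemma pochhammerD x (a b : nat) :
  pochhammer x (a + b)%N%:Z = pochhammer x a%:Z * pochhammer (x + a%:R) b%:Z.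
Proof.
elim: b => [|b IHb]; first by rewrite addn0 pochhammer0 mulr1.
by rewrite addnS !pochhammerSr IHb natrD; ring.
Qed.

Lemma pochhammer_step x m : nonint x ->
  pochhammer x (m + 1) = pochhammer x m * (x + m%:~R).
Proof.
move=> hx; case: m => k.
  by rewrite -PoszD addn1 pochhammerSr.
have {}hx i : x + (Negz k)%:~R + i%:R != 0 by rewrite -addrA (pmulrn 1 i) -intrD.
rewrite [in RHS]/pochhammer big_ord_recl addr0 invfM mulrAC mulVf; last first.
  by have := hx 0%N; rewrite addr0.
rewrite mul1r; case: k hx => [|k] hx; first by rewrite big_ord0 invr1 pochhammer0.
rewrite (_ : Negz k.+1 + 1 = Negz k) /=; last by lia.
congr (_^-1); apply: eq_bigr => i _; rewrite -[bump 0 i]/i.+1.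
rewrite (_ : Negz k = Negz k.+1 + 1); last by lia.
by rewrite -natr1 intrD; ring.
Qed.

Lemma pochhammer_neq0 x m : nonint x -> pochhammer x m != 0.
Proof.
move=> hx; case: m => k; rewrite /= ?invr_eq0; apply/prodf_neq0 => i _.
  exact: hx i.
by rewrite -addrA (pmulrn 1 i) -intrD.
Qed.

(** 1/m! continued by 0 to negative m, as for the reciprocal Gamma function. The recurrence
    [invfact_step] then holds at every integer, at m = -1 thanks to the factor m + 1. *)
Definition invfact m : F := if m is Posz k then (k`!%:R)^-1 else 0.

Hypothesis char0 : [pchar F] =i pred0.

Lemma natS_neq0 k : k.+1%:R != 0 :> F.
Proof. by rewrite ((pcharf0P F).1 char0). Qed.

Lemma fact_neq0 k : k`!%:R != 0 :> F.
Proof. by rewrite -(prednK (fact_gt0 k)) natS_neq0. Qed.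

Lemma invfact_step m : invfact m = (m%:~R + 1) * invfact (m + 1).
Proof.
case: m => k /=; last first.
  case: k => [|k]; first by rewrite NegzE addNr mul0r.
  by rewrite (_ : Negz k.+1 + 1 = Negz k) /= ?mulr0 //; lia.
rewrite addn1 factS natrM invfM mulrA -[k%:~R]/(k%:R) natr1 mulfV ?mul1r //.
exact: natS_neq0.
Qed.

End Pochhammer.

(** * Evaluation of Krattenthaler's two-parameter determinant *)

Section Krattenthaler.

Variables (F : fieldType) (h : F).
Hypotheses (char0 : [pchar F] =i pred0) (generic : nonint (2%:R * h)).
Implicit Types (x t m : int) (i j k n : nat).

Local Notation g := (pochhammer h).
Local Notation invfact := (invfact F).

Lemma half_generic : nonint h.
Proof.
move=> m; have := generic (2 * m); rewrite intrM -mulrDr mulf_eq0 negb_or.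
by case/andP.
Qed.

Lemma generic_neq0 m (a : F) : a = h + m%:~R -> a != 0.
Proof. by move->; apply: half_generic. Qed.

Lemma g_neq0 m : g m != 0.
Proof. exact: pochhammer_neq0 half_generic. Qed.

Lemma g_step m m' : m' = m + 1 -> g m' = g m * (h + m%:~R).
Proof. by move->; apply: pochhammer_step half_generic. Qed.

Lemma invfact_stepE m m' : m' = m + 1 -> invfact m = (m%:~R + 1) * invfact m'.
Proof. by move->; apply: invfact_step. Qed.

(** With y = h + t this is (x + y + i + j - 1)! / ((x + 2i - j)! (y + 2j - i)!). Factorials at
    non-integers are Gamma values, and [g] is Gamma(h + m) / Gamma(h), where the denominators cancel
    in the quotient. *)
Definition kratt x t i j : F :=
  g (x + t + i%:Z + j%:Z) * invfact (x + 2 * i%:Z - j%:Z) / g (t + 2 * j%:Z - i%:Z + 1).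

Definition kratt_factor x t k : F :=
  k`!%:R * g (x + t + k%:Z) * pochhammer (2%:R * x%:~R + (h + t%:~R) + 2%:R * k%:R) k%:Z
  * pochhammer (x%:~R + 2%:R * (h + t%:~R) + 2%:R * k%:R) k%:Z
  * invfact (x + 2 * k%:Z) / g (t + 2 * k%:Z + 1).

Definition kratt_prod n x t : F := \prod_(k < n) kratt_factor x t k.

(** The four parameter pairs are those of the n + 1 minors in Dodgson's identity. Their Pochhammer
    symbols agree in pairs, so only steps of [g] and [invfact] remain. The cubic multipliers are one
    expression taken at k + 1 and at k, so they telescope in [kratt_prod_cross]. *)
Lemma kratt_factor_cross x t k :
  kratt_factor (x + 2) (t - 1) k * kratt_factor (x - 1) (t + 2) k *
    ((h + t%:~R + x%:~R + k.+1%:R) * (x%:~R + 2%:R * k.+1%:R)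
     * (h + t%:~R + 2%:R * k.+1%:R)) =
  kratt_factor x t k * kratt_factor (x + 1) (t + 1) k *
    ((h + t%:~R + x%:~R + k%:R) * (x%:~R + 2%:R * k%:R)
     * (h + t%:~R + 2%:R * k%:R)).
Proof.
rewrite /kratt_factor.
rewrite (_ : 2%:R * (x + 2)%:~R + (h + (t - 1)%:~R) + 2%:R * k%:R =
  2%:R * (x + 1)%:~R + (h + (t + 1)%:~R) + 2%:R * k%:R); last by ring.
rewrite (_ : 2%:R * (x - 1)%:~R + (h + (t + 2)%:~R) + 2%:R * k%:R =
  2%:R * x%:~R + (h + t%:~R) + 2%:R * k%:R); last by ring.
rewrite (_ : (x + 2)%:~R + 2%:R * (h + (t - 1)%:~R) + 2%:R * k%:R =
  x%:~R + 2%:R * (h + t%:~R) + 2%:R * k%:R); last by ring.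
rewrite (_ : (x - 1)%:~R + 2%:R * (h + (t + 2)%:~R) + 2%:R * k%:R =
  (x + 1)%:~R + 2%:R * (h + (t + 1)%:~R) + 2%:R * k%:R); last by ring.
rewrite (_ : x + 2 + (t - 1) + k%:Z = x + t + k%:Z + 1); last by ring.
rewrite (_ : x - 1 + (t + 2) + k%:Z = x + t + k%:Z + 1); last by ring.
rewrite (_ : x + 1 + (t + 1) + k%:Z = x + t + k%:Z + 1 + 1); last by ring.
rewrite (_ : x + 1 + 2 * k%:Z = x + 2 * k%:Z + 1); last by ring.
rewrite (_ : x - 1 + 2 * k%:Z = x + 2 * k%:Z - 1); last by ring.
rewrite (_ : x + 2 + 2 * k%:Z = x + 2 * k%:Z + 1 + 1); last by ring.
rewrite (@invfact_stepE (_ - 1) _ (esym (subrK 1 (x + 2 * k%:Z)))).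
rewrite (@invfact_stepE (x + 2 * k%:Z) _ erefl) (@invfact_stepE (x + 2 * k%:Z + 1) _ erefl).
rewrite (_ : t - 1 + 2 * k%:Z + 1 = t + 2 * k%:Z); last by ring.
rewrite (_ : t + 2 + 2 * k%:Z = t + 2 * k%:Z + 1 + 1); last by ring.
rewrite (_ : t + 1 + 2 * k%:Z = t + 2 * k%:Z + 1); last by ring.
rewrite !(g_step (erefl (_ + 1))).
have := g_neq0 (t + 2 * k%:Z).
have n0 (m : int) a : a = h + t%:~R + 2%:R * k%:R + m%:~R -> a != 0.
  by move->; apply: (@generic_neq0 (t + 2 * k%:Z + m)); ring.
move: (g (t + 2 * k%:Z)) (g (x + t + k%:Z)) (invfact _) (pochhammer _ _) (pochhammer _ _).
move: (pochhammer _ _) (pochhammer _ _) => p1 p2 g1 g2 i1 p3 p4 gn0.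
field.
by apply/and4P; split=> //; [apply: (n0 1)|apply: (n0 0)|apply: (n0 2)]; ring.
Qed.

(** In Dodgson's identity the (n + 2) determinant brings in the factor k + 1 at (x, t), and one
    minor brings in the factor k at (x + 1, t + 1). This compares the two without denominators. *)
Lemma kratt_factorS x t k :
  kratt_factor x t k.+1 *
    ((h + t%:~R + x%:~R + k.+1%:R) * (x%:~R + 2%:R * k.+1%:R)
     * (h + t%:~R + 2%:R * k.+1%:R)) =
  k.+1%:R * (2%:R * x%:~R + (h + t%:~R) + 2%:R * k.+1%:R)
    * (x%:~R + 2%:R * (h + t%:~R) + 2%:R * k.+1%:R) * kratt_factor (x + 1) (t + 1) k.
Proof.
rewrite /kratt_factor !pochhammerSl factS natrM.
rewrite (_ : 2%:R * (x + 1)%:~R + (h + (t + 1)%:~R) + 2%:R * k%:R =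
  2%:R * x%:~R + (h + t%:~R) + 2%:R * k.+1%:R + 1); last by ring.
rewrite (_ : (x + 1)%:~R + 2%:R * (h + (t + 1)%:~R) + 2%:R * k%:R =
  x%:~R + 2%:R * (h + t%:~R) + 2%:R * k.+1%:R + 1); last by ring.
rewrite (_ : x + 1 + (t + 1) + k%:Z = x + t + k.+1%:Z + 1); last by lia.
rewrite (_ : t + 1 + 2 * k%:Z + 1 = t + 2 * k.+1%:Z); last by lia.
rewrite (@invfact_stepE (x + 1 + 2 * k%:Z) (x + 2 * k.+1%:Z)); last by lia.
rewrite !(g_step (erefl (_ + 1))).
have gn0 := g_neq0 (t + 2 * k.+1%:Z).
have n0 a : a = h + t%:~R + 2%:R * k.+1%:R -> a != 0.
  by move->; apply: (@generic_neq0 (t + 2 * k.+1%:Z)); ring.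
move: (g (t + 2 * k.+1%:Z)) (g (x + t + k.+1%:Z)) (invfact _) (pochhammer _ _) gn0.
move: (pochhammer _ _) => p1 g1 g2 i1 p2 gn0.
field.
by rewrite gn0 n0 //; ring.
Qed.

Lemma kratt_prod_cross n x t :
  kratt_prod n (x + 2) (t - 1) * kratt_prod n (x - 1) (t + 2) *
    ((h + t%:~R + x%:~R + n%:R) * (x%:~R + 2%:R * n%:R) * (h + t%:~R + 2%:R * n%:R)) =
  x%:~R * (h + t%:~R) * (x%:~R + (h + t%:~R))
    * (kratt_prod n x t * kratt_prod n (x + 1) (t + 1)).
Proof.
elim: n => [|n IHn]; first by rewrite /kratt_prod !big_ord0; ring.
rewrite /kratt_prod !big_ord_recr /= -!/(kratt_prod n _ _).
have := kratt_factor_cross x t n.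
move: (kratt_factor (x + 2) _ _) (kratt_factor (x - 1) _ _) => f1 f2.
move: (kratt_factor x _ _) (kratt_factor (x + 1) _ _) => f3 f4 f_cross.
rewrite [LHS](_ : _ = kratt_prod n (x + 2) (t - 1) * kratt_prod n (x - 1) (t + 2) * (f1 * f2 *
  ((h + t%:~R + x%:~R + n.+1%:R) * (x%:~R + 2%:R * n.+1%:R) * (h + t%:~R + 2%:R * n.+1%:R)))).
  rewrite f_cross mulrCA IHn; ring.
ring.
Qed.

(** For x >= 0 the [invfact] factors do not vanish. The symbol based at x + 2 (h + t) + 2k is the
    reason why [generic] concerns 2h rather than h. *)
Lemma kratt_prod_neq0 n x t : 0 <= x -> kratt_prod n x t != 0.
Proof.
move=> x0; apply/prodf_neq0 => -[k lt_kn] _; rewrite /kratt_factor /=.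
case: x x0 => // x _.
rewrite !mulf_neq0 ?invr_eq0 ?fact_neq0 ?g_neq0 //.
- apply: (@pochhammer_neq0 _ _ k%:Z) => m.
  by apply: (@generic_neq0 (2 * x%:Z + t + 2 * k%:Z + m)); ring.
- apply: (@pochhammer_neq0 _ _ k%:Z) => m.
  rewrite (_ : _ + _ = 2%:R * h + (x%:Z + 2 * t + 2 * k%:Z + m)%:~R) //; ring.
Qed.

(* With y = h + t and N = n + 1, Dodgson's identity reduces to
   N (2x + y + 2N) (x + 2y + 2N) = (x + y + N) (x + 2N) (y + 2N) - x y (x + y).
   It involves the parameter x - 1, hence the case x = -1, where row 0 vanishes. *)
Lemma kratt_det n x t : -1 <= x -> window_det n (kratt x t) = kratt_prod n x t.
Proof.
elim/ltn_ind: n x t => -[|[|n]] IHn x t x_ge.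
- by rewrite /window_det det_mx00 /kratt_prod big_ord0.
- rewrite /window_det det_mx11 !mxE /kratt_prod big_ord1 /kratt /kratt_factor !pochhammer0 /=.
by rewrite !(mulr0, addr0) mul1r !mulr1.
have [x_lt0|x0] := ltP x 0.
  have -> : x = -1 by lia.
  have -> : kratt_prod n.+2 (-1) t = 0.
    by rewrite /kratt_prod big_ord_recl /kratt_factor /= mulr0 mul0r mul0r.
  rewrite /window_det (expand_det_row _ ord0) big1 // => j _.
  rewrite !mxE /kratt (_ : -1 + 2 * (@ord0 n.+1)%:Z - j%:Z = Negz j) /=; last by rewrite NegzE; lia.
  by rewrite mulr0 !mul0r.
(* Deleting a first row or column only shifts (x, t), so the induction hypothesis evaluates all the
   minors. *)
have sh_dr : forall i j, kratt x t i.+1 j.+1 = kratt (x + 1) (t + 1) i j.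
  by move=> i j; rewrite /kratt; congr (g _ * invfact _ / g _); lia.
have sh_d : forall i j, kratt x t i.+1 j = kratt (x + 2) (t - 1) i j.
  by move=> i j; rewrite /kratt; congr (g _ * invfact _ / g _); lia.
have sh_r : forall i j, kratt x t i j.+1 = kratt (x - 1) (t + 2) i j.
  by move=> i j; rewrite /kratt; congr (g _ * invfact _ / g _); lia.
have cn0 := @kratt_prod_neq0 n (x + 1) (t + 1) ltac:(lia).
have ctr k : window_det k (fun i j => kratt x t i.+1 j.+1) =
    window_det k (kratt (x + 1) (t + 1)) by apply: eq_window_det => i j _ _.
have dod := @dodgson _ n (kratt x t).
rewrite !ctr (@eq_window_det _ _ (fun i j => kratt x t i.+1 j) (kratt (x + 2) (t - 1))) // in dod.
rewrite (@eq_window_det _ _ (fun i j => kratt x t i j.+1) (kratt (x - 1) (t + 2))) // in dod.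
rewrite (IHn n) ?(IHn n.+1) // in dod; try lia.
move/(_ cn0): dod => dod.
(* The common multiplier of [kratt_prod_cross] and [kratt_factorS]; multiplying by it reduces the
   goal to a polynomial identity. *)
have N0 : (h + t%:~R + x%:~R + n.+1%:R) * (x%:~R + 2%:R * n.+1%:R)
    * (h + t%:~R + 2%:R * n.+1%:R) != 0.
  rewrite !mulf_neq0 //.
  - by apply: (@generic_neq0 (t + x + n.+1%:Z)); ring.
  - case: x x0 {x_ge dod sh_dr sh_d sh_r ctr cn0} => // x _.
    rewrite (_ : _ + _ = (x + (2 * n).+1).+1%:R) ?natS_neq0 //; ring.
  - by apply: (@generic_neq0 (t + 2 * n.+1%:Z)); ring.
apply: (mulIf cn0); apply: (mulIf N0); rewrite dod mulrBl.
rewrite (_ : kratt_prod n.+2 x t = kratt_prod n.+1 x t * kratt_factor x t n.+1); last first.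
  by rewrite /kratt_prod big_ord_recr.
rewrite kratt_prod_cross.
have fS := kratt_factorS x t n.
transitivity (kratt_prod n.+1 x t * kratt_prod n (x + 1) (t + 1) * (kratt_factor x t n.+1 *
  ((h + t%:~R + x%:~R + n.+1%:R) * (x%:~R + 2%:R * n.+1%:R) * (h + t%:~R + 2%:R * n.+1%:R)))).
  rewrite fS (_ : kratt_prod n.+1 (x + 1) (t + 1) =
    kratt_prod n (x + 1) (t + 1) * kratt_factor (x + 1) (t + 1) n); last first.
    by rewrite /kratt_prod big_ord_recr.
  ring.
ring.
Qed.

End Krattenthaler.

(** * Rising binomials, the coefficients of (1 - x)^(-c) *)

Section RisingBinomial.

Variable F : fieldType.
Hypothesis char0 : [pchar F] =i pred0.
Implicit Types (a b c : F) (m : int) (i j k n : nat).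

Definition rbin c m : F := pochhammer c m * invfact F m.

Lemma rbin0 c : rbin c 0 = 1.
Proof. by rewrite /rbin pochhammer0 /= invr1 mulr1. Qed.

Lemma rbin_neg c m : m < 0 -> rbin c m = 0.
Proof. by case: m => // k _; rewrite /rbin /= mulr0. Qed.

Lemma rbinS c k : k.+1%:R * rbin c k.+1%:Z = c * rbin (c + 1) k%:Z.
Proof.
rewrite /rbin pochhammerSl /invfact factS natrM; field.
by rewrite nat1r natS_neq0 ?fact_neq0.
Qed.

(** Coefficient of x^m in (1 - x)^(-c) - (1 - x)^(1 - c) = x (1 - x)^(-c). *)
Lemma rbin_pascal c m : rbin c m - rbin (c - 1) m = rbin c (m - 1).
Proof.
case: m => [[|k]|k]; last by rewrite !rbin_neg ?subr0.
  by rewrite !rbin0 subrr rbin_neg.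
rewrite (_ : k.+1%:Z - 1 = k); last by lia.
rewrite /rbin pochhammerSr (pochhammerSl (c - 1)) subrK /invfact factS natrM; field.
by rewrite nat1r natS_neq0 ?fact_neq0.
Qed.

Lemma rbin_reflect c k : rbin c k%:Z = (-1) ^+ k * rbin (1 - k%:R - c) k%:Z.
Proof.
rewrite /rbin mulrA; congr (_ * _) => /=.
rewrite -[in X in X * _](card_ord k) -prodr_const -big_split /=.
rewrite (reindex_inj rev_ord_inj) /=; apply: eq_bigr => i _.
rewrite natrB // -natr1; ring.
Qed.

Lemma rbin_vandermonde a b n :
  \sum_(j < n.+1) rbin a j%:Z * rbin b (n%:Z - j%:Z) = rbin (a + b) n%:Z.
Proof.
elim: n a b => [|n IHn] a b; first by rewrite big_ord1 subr0 !rbin0 mulr1.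
apply: (mulfI (natS_neq0 char0 n)); rewrite rbinS mulr_sumr.
(* The factor n + 1 is split as j + (n + 1 - j), and [rbinS] absorbs each part: this is the product
   rule for the derivative of (1 - x)^(-a) (1 - x)^(-b). *)
transitivity (\sum_(j < n.+2) (j%:R * rbin a j%:Z) * rbin b (n.+1%:Z - j%:Z) +
   \sum_(j < n.+2) rbin a j%:Z * ((n.+1 - j)%N%:R * rbin b (n.+1 - j)%N%:Z)).
  rewrite -big_split; apply: eq_bigr => j _ /=.
  have lejn : (j <= n.+1)%N by rewrite -ltnS.
  rewrite (_ : n.+1%:R = j%:R + (n.+1 - j)%N%:R :> F) ?subzn //; first by ring.
  by rewrite -natrD subnKC.
rewrite big_ord_recl mul0r mul0r add0r [X in _ + X]big_ord_recr /= subnn mul0r mulr0 addr0.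
transitivity (\sum_(j < n.+1) a * (rbin (a + 1) j%:Z * rbin b (n%:Z - j%:Z)) +
   \sum_(j < n.+1) b * (rbin a j%:Z * rbin (b + 1) (n%:Z - j%:Z))).
  congr (_ + _); apply: eq_bigr => j _.
    by rewrite -[bump 0 j]/j.+1 rbinS mulrA; congr (_ * rbin _ _); lia.
  rewrite subSn -1?ltnS // rbinS mulrCA subzn //; exact: ltn_ord j.
rewrite -!mulr_sumr !IHn addrA [a + 1 + b]addrAC; ring.
Qed.

End RisingBinomial.

(** * The functionals that encode row combinations *)

Section Functionals.

Variable F : fieldType.
Implicit Types (w : nat -> F) (p q : {poly F}) (c g : F) (m : int) (i j k n : nat).

Definition coef_pairing w p : F := \sum_(i < size p) p`_i * w i.

Lemma coef_pairingE n w p : (size p <= n)%N -> coef_pairing w p = \sum_(i < n) p`_i * w i.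
Proof.
move=> le_pn; rewrite /coef_pairing (big_ord_widen n (fun i => p`_i * w i) le_pn).
rewrite big_mkcond; apply: eq_bigr => i _; case: ltnP => // /(nth_default 0) ->.
by rewrite mul0r.
Qed.

Lemma eq_coef_pairing w w' p : w =1 w' -> coef_pairing w p = coef_pairing w' p.
Proof. by move=> eqw; apply: eq_bigr => i _; rewrite eqw. Qed.

Lemma coef_pairingD w p q : coef_pairing w (p + q) = coef_pairing w p + coef_pairing w q.
Proof.
set n := maxn (size p) (size q).
rewrite !(@coef_pairingE n) ?leq_maxl ?leq_maxr ?(leq_trans (size_polyD _ _)) //.
by rewrite -big_split; apply: eq_bigr => i _; rewrite coefD mulrDl.
Qed.

Lemma coef_pairingZ w a p : coef_pairing w (a *: p) = a * coef_pairing w p.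
Proof.
rewrite (@coef_pairingE (size p)) ?size_scale_leq // mulr_sumr.
by apply: eq_bigr => i _; rewrite coefZ mulrA.
Qed.

Lemma coef_pairing1 w : coef_pairing w 1 = w 0%N.
Proof. by rewrite /coef_pairing size_poly1 big_ord1 coef1 mul1r. Qed.

Lemma coef_pairing_mulX w p : coef_pairing w (p * 'X) = coef_pairing (w \o succn) p.
Proof.
rewrite (@coef_pairingE (size p).+1); last first.
  by rewrite (leq_trans (size_polyMleq _ _)) // size_polyX addn2.
rewrite big_ord_recl coefMX mul0r add0r.
by apply: eq_bigr => i _; rewrite coefMX.
Qed.

Lemma coef_pairing_mulXB1 w p :
  coef_pairing w (p * ('X - 1)) = coef_pairing (fun i => w i.+1 - w i) p.
Proof.
rewrite mulrBr mulr1 -scaleN1r coef_pairingD coef_pairingZ coef_pairing_mulX mulN1r.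
by rewrite /coef_pairing -sumrB; apply: eq_bigr => i _; rewrite mulrBr.
Qed.

(** [Phi g m p] is the coefficient of x^m in p(x) (1 - x)^(-g), and [Psi c m p] that in p(1 / (1 -
    x)) (1 - x)^(-c). The multiplication rules follow: X - 1 becomes -(1 - x) in the first and x /
    (1 - x) in the second. *)
Definition Phi g m p : F := coef_pairing (fun i => rbin g (m - i%:Z)) p.
Definition Psi c m p : F := coef_pairing (fun i => rbin (c + i%:R) m) p.

Hypothesis char0 : [pchar F] =i pred0.

Lemma Phi_mulX g m p : Phi g m (p * 'X) = Phi g (m - 1) p.
Proof.
by rewrite /Phi coef_pairing_mulX; apply: eq_coef_pairing => i /=; congr rbin; lia.
Qed.

Lemma Psi_mulX c m p : Psi c m (p * 'X) = Psi (c + 1) m p.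
Proof.
rewrite /Psi coef_pairing_mulX; apply: eq_coef_pairing => i /=; congr rbin.
by rewrite -natr1; ring.
Qed.

Lemma Phi_mulXB1 g m p : Phi g m (p * ('X - 1)) = - Phi (g - 1) m p.
Proof.
rewrite /Phi coef_pairing_mulXB1 /coef_pairing -sumrN; apply: eq_bigr => i _.
rewrite -[RHS]mulrN; congr (_ * _); rewrite (_ : m - i.+1%:Z = m - i%:Z - 1); last by lia.
by rewrite -rbin_pascal // addrAC subrr sub0r.
Qed.

Lemma Psi_mulXB1 c m p : Psi c m (p * ('X - 1)) = Psi (c + 1) (m - 1) p.
Proof.
rewrite /Psi coef_pairing_mulXB1; apply: eq_coef_pairing => i.
rewrite -rbin_pascal //; congr (rbin _ _ - rbin _ _); rewrite -?natr1; ring.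
Qed.

(** X (X - 1) acts as -x (1 - x) under [Phi], and as x / (1 - x)^2 under [Psi] in the next lemma. *)
Lemma Phi_mulXB1X g m k p :
  Phi g m (p * ('X * ('X - 1)) ^+ k) = (-1) ^+ k * Phi (g - k%:R) (m - k%:Z) p.
Proof.
elim: k g m => [|k IHk] g m; first by rewrite expr0 mulr1 mul1r !subr0.
rewrite exprSr !mulrA Phi_mulXB1 Phi_mulX IHk exprS mulN1r mulNr; congr (- (_ * Phi _ _ _)).
  by rewrite -natr1; ring.
lia.
Qed.

Lemma Psi_mulXB1X c m k p :
  Psi c m (p * ('X * ('X - 1)) ^+ k) = Psi (c + 2%:R * k%:R) (m - k%:Z) p.
Proof.
elim: k c m => [|k IHk] c m; first by rewrite expr0 mulr1 mulr0 addr0 subr0.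
rewrite exprSr !mulrA Psi_mulXB1 Psi_mulX IHk; congr (Psi _ _ _); last by lia.
by rewrite -natr1; ring.
Qed.

End Functionals.

(** * Row, column and block operations on determinants *)

Section WindowDeterminants.

Variable F : fieldType.
Implicit Types (M : nat -> nat -> F) (n s a b : nat).

Lemma window_det_tr n M : window_det n (fun i j => M j i) = window_det n M.
Proof.
rewrite /window_det -[RHS]det_tr; congr determinant.
by apply/matrixP => i j; rewrite !mxE.
Qed.

Lemma window_det_scale_rows n (u : nat -> F) M :
  window_det n (fun i j => u i * M i j) = \prod_(i < n) u i * window_det n M.
Proof.
have -> : window_det n (fun i j => u i * M i j) =
    \det (diag_mx (\row_(i < n) u i) *m \matrix_(i < n, j < n) M i j).
  by congr determinant; rewrite mul_diag_mx; apply/matrixP => i j; rewrite !mxE.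
by rewrite det_mulmx det_diag; congr (_ * _); apply: eq_bigr => i _; rewrite mxE.
Qed.

Lemma window_det_unitriangular n M :
  (forall i, M i i = 1) -> (forall i j, (j < i)%N -> M i j = 0) -> window_det n M = 1.
Proof.
move=> M1 M0; rewrite -window_det_tr /window_det det_trig.
  by rewrite big1 // => i _; rewrite mxE.
by apply/is_trig_mxP => i j lt_ij; rewrite mxE M0.
Qed.

Lemma window_det_ublock s n M :
  (forall i j, (s <= i)%N -> (j < s)%N -> M i j = 0) ->
  window_det (s + n) M = window_det s M * window_det n (fun i j => M (s + i)%N (s + j)%N).
Proof.
move=> M0.
rewrite -(det_ublock _ (\matrix_(i < s, j < n) M i (s + j)%N)); congr determinant.
apply/matrixP => i j; rewrite !mxE.
do 2![case: splitP => ? ->; rewrite !mxE] => //.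
by rewrite M0 ?leq_addr.
Qed.

(** Listing the even indices before the odd ones, for rows and columns alike, costs no sign and
    makes the matrix block diagonal. Here [c] is the parity of the size. *)
Lemma window_det_checkerboard (c n : nat) M :
  (c <= 1)%N ->
  (forall i j, odd i != odd j -> M i j = 0) ->
  window_det (n + c + n) M =
    window_det (n + c) (fun i j => M i.*2 j.*2)
    * window_det n (fun i j => M i.*2.+1 j.*2.+1).
Proof.
move=> c_le1 M0.
pose f (i : nat) := if (i < n + c)%N then i.*2 else (i - (n + c)).*2.+1.
have f_lt (i : 'I_(n + c + n)) : (f i < n + c + n)%N.
  by have lt_i := ltn_ord i; rewrite /f; case: (ltnP i (n + c)); lia.
pose sf i := Ordinal (f_lt i).
have sf_inj : injective sf.
  move=> i j /(congr1 val) /=; rewrite /f => eq_f; apply: val_inj => /=.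
  by move: eq_f; case: (ltnP i (n + c)); case: (ltnP j (n + c)); lia.
have -> : window_det (n + c + n) M = window_det (n + c + n) (fun i j => M (f i) (f j)).
  transitivity (\det (\matrix_(i, j) (\matrix_(i < n + c + n, j < n + c + n) M i j)
      (perm sf_inj i) (perm sf_inj j))).
    by rewrite det_reindex -expr2 sqrr_sign mul1r.
  by congr determinant; apply/matrixP => i j; rewrite !mxE !permE.
rewrite window_det_ublock; last first.
  move=> i j; rewrite leqNgt /f => /negbTE -> ->.
  by rewrite M0 //= !odd_double.
congr (_ * _); apply: eq_window_det => i j lti ltj; rewrite /f.
  by rewrite lti ltj.
by rewrite !ltnNge !leq_addr /= !addKn.
Qed.

(* Row k is replaced by the combination of the rows whose weights are the
   coefficients of e k. *)
Lemma window_det_pairing n M (e : nat -> {poly F}) (C : nat -> nat -> F) :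
  (forall k, e k \is monic) -> (forall k, size (e k) = k.+1) ->
  (forall k, C k k = 1) -> (forall j k, (k < j)%N -> C j k = 0) ->
  window_det n M =
  window_det n (fun k l => coef_pairing (fun i => \sum_(j < n) M i j * C j l) (e k)).
Proof.
move=> e_monic size_e C1 C0.
have dC : window_det n C = 1 by apply: window_det_unitriangular.
have de : window_det n (fun k i => (e k)`_i) = 1.
  rewrite -window_det_tr; apply: window_det_unitriangular => [i|i j lt_ji].
    by have /monicP := e_monic i; rewrite lead_coefE size_e.
  by rewrite nth_default // size_e.
rewrite -[LHS]mul1r -de -[LHS]mulr1 -dC -!det_mulmx; congr determinant.
apply/matrixP => k l; rewrite !mxE (@coef_pairingE _ n) ?size_e //.
under eq_bigr => j _ do rewrite !mxE mulr_suml.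
rewrite exchange_big; apply: eq_bigr => i _; rewrite mulr_sumr.
by apply: eq_bigr => j _; rewrite !mxE mulrA.
Qed.

End WindowDeterminants.

(** * Combined entries of the matrix, and the reduction to s = 0 *)

Section Entries.

Variables (F : fieldType) (nu : F).
Hypothesis char0 : [pchar F] =i pred0.
Implicit Types (g : F) (p : {poly F}) (n s i j N : nat).

Definition delta_binom s i j : F := (s + i == j)%N%:R + rbin (nu + (s + i)%:R) j%:Z.

Lemma delta_binom_pairing n s i N g : (N < n)%N ->
  \sum_(j < n) delta_binom s i j * rbin g (N%:Z - j%:Z) =
  rbin g (N%:Z - s%:Z - i%:Z) + rbin (nu + s%:R + g + i%:R) N%:Z.
Proof.
move=> lt_Nn; under eq_bigr => j _ do rewrite mulrDl.
rewrite big_split /=; congr (_ + _).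
  have [lt_sn|le_ns] := ltnP (s + i) n.
    rewrite (bigD1 (Ordinal lt_sn)) //= eqxx mul1r big1 ?addr0 => [|j /eqP ne_j].
      by congr rbin; lia.
    by case: eqP => [eq_j|]; rewrite ?mul0r //; case: ne_j; apply: val_inj.
  (* No column meets the diagonal in this row, and N < n <= s + i makes the claimed term vanish as
     well. *)
  rewrite rbin_neg; last by lia.
  rewrite big1 // => j _; rewrite (_ : (s + i == j)%N = false) ?mul0r //.
  by have := ltn_ord j; case: eqP => //; lia.
rewrite (_ : nu + s%:R + g + i%:R = nu + (s + i)%:R + g); last by rewrite natrD; ring.
rewrite -rbin_vandermonde //.
rewrite [RHS](big_ord_widen n (fun j => rbin (nu + (s + i)%:R) j%:Z * rbin g (N%:Z - j%:Z))) //.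
rewrite [RHS]big_mkcond; apply: eq_bigr => j _; rewrite ltnS; case: leqP => // lt_Nj.
by rewrite (rbin_neg g) ?mulr0 //; lia.
Qed.

Lemma coef_pairing_delta_binom n s N g p : (N < n)%N ->
  coef_pairing (fun i => \sum_(j < n) delta_binom s i j * rbin g (N%:Z - j%:Z)) p =
  Phi g (N%:Z - s%:Z) p + Psi (nu + s%:R + g) N%:Z p.
Proof.
move=> lt_Nn; rewrite /Phi /Psi /coef_pairing -big_split; apply: eq_bigr => i _ /=.
by rewrite delta_binom_pairing // mulrDr.
Qed.

End Entries.

Lemma window_det_delta_binom_shift (F : fieldType) (nu : F) (s n : nat) :
  [pchar F] =i pred0 -> ~~ odd s ->
  window_det (s + n) (delta_binom nu s) =
  window_det n (delta_binom (nu + (3 * s)%:R) 0).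
Proof.
move=> char0 even_s.
pose e k : {poly F} := 'X ^+ (k - s) * ('X - 1) ^+ (minn k s).
have XB1_monic : ('X - 1 : {poly F}) \is monic by rewrite -[1]/(1%:P) monicXsubC.
have e_monic k : e k \is monic by rewrite monicMl ?monicXn ?monic_exp.
have size_e k : size (e k) = k.+1.
  rewrite size_Mmonic ?monic_exp // ?monic_neq0 ?monicXn // size_polyXn.
  rewrite -[1]/(1%:P) size_exp_XsubC; lia.
rewrite (@window_det_pairing _ _ _ e (fun j k => rbin s%:R (k%:Z - j%:Z))) //; first last.
- by move=> j k lt_kj; rewrite rbin_neg //; lia.
- by move=> k; rewrite subrr rbin0.
have Phi_XB1 g m k p : Phi g m (p * ('X - 1) ^+ k) = (-1) ^+ k * Phi (g - k%:R) m p :> F.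
  elim: k g => [|k IHk] g; first by rewrite expr0 mulr1 mul1r subr0.
  rewrite exprSr mulrA Phi_mulXB1 // IHk exprS mulN1r mulNr; congr (- (_ * Phi _ _ _)).
  by rewrite -natr1; ring.
have Psi_XB1 c m k p : Psi c m (p * ('X - 1) ^+ k) = Psi (c + k%:R) (m - k%:Z) p :> F.
  elim: k c m => [|k IHk] c m; first by rewrite expr0 mulr1 addr0 subr0.
  rewrite exprSr mulrA Psi_mulXB1 // IHk; congr (Psi _ _ _); last by lia.
  by rewrite -natr1; ring.
have Phi_X g m k : Phi g m 'X^k = rbin g (m - k%:Z) :> F.
  elim: k m => [|k IHk] m; first by rewrite expr0 /Phi coef_pairing1 subr0.
  by rewrite exprSr Phi_mulX IHk; congr rbin; lia.
have Psi_X c m k : Psi c m 'X^k = rbin (c + k%:R) m :> F.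
  elim: k c => [|k IHk] c; first by rewrite expr0 /Psi coef_pairing1.
  by rewrite exprSr Psi_mulX IHk; congr rbin; rewrite -natr1; ring.
(* For l < s the [Phi] term has a negative index. In those columns the rows k < s are therefore
   unitriangular and the rows k >= s are zero. *)
pose W k l : F := (-1) ^+ minn k s * rbin (s%:R - (minn k s)%:R) (l%:Z - s%:Z - (k - s)%N%:Z)
  + rbin (nu + 2%:R * s%:R + k%:R) (l%:Z - (minn k s)%:Z).
rewrite (@eq_window_det _ _ _ W); last first.
  move=> k l _ lt_l; rewrite coef_pairing_delta_binom // Phi_XB1 Psi_XB1 Phi_X Psi_X.
  congr (_ + rbin _ _).
  rewrite -[in RHS](subnK (geq_minl k s)) (_ : (k - minn k s = k - s)%N) ?natrD; last by lia.
  ring.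
rewrite window_det_ublock => [|k l le_sk lt_ls]; last first.
  by rewrite /W (minn_idPr le_sk) !rbin_neg ?mulr0 ?addr0 //; lia.
rewrite (@eq_window_det _ s _
    (fun k l => rbin (nu + 2%:R * s%:R + k%:R) (l%:Z - k%:Z))); last first.
  move=> k l lt_k lt_l; rewrite /W (minn_idPl (ltnW lt_k)).
  rewrite [X in _ * X + _]rbin_neg ?mulr0 ?add0r //.
  lia.
rewrite window_det_unitriangular ?mul1r => [||k l lt_lk]; last first.
- by rewrite rbin_neg //; lia.
- by move=> k; rewrite subrr rbin0.
(* In the last block the exponent s - s = 0 turns the [Phi] term into a Kronecker delta, whose sign
   (-1)^s is 1 since [s] is even. The row index s + k supplies the third multiple of s. *)
apply: eq_window_det => k l _ _; rewrite /W /delta_binom (minn_idPr (leq_addr _ _)).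
rewrite subrr -signr_odd (negbTE even_s) mul1r add0n addKn.
rewrite (_ : (s + l)%N%:Z - s%:Z = l%:Z); last by lia.
congr (_ + rbin _ _); last by rewrite !natrD; ring.
have [->|ne_kl] := eqVneq k l; first by rewrite subrr rbin0.
have [lt_lk|le_kl] := ltnP l k; first by rewrite rbin_neg //; lia.
have lt_kl : (k < l)%N by rewrite ltn_neqAle ne_kl.
rewrite subzn // -(prednK (_ : 0 < l - k)%N) ?subn_gt0 //.
by rewrite /rbin pochhammerSl !mul0r.
Qed.

(** * The case s = 0: splitting by parity into two Krattenthaler determinants *)

Section Andrews.

Variables (F : fieldType) (h : F).
Hypotheses (char0 : [pchar F] =i pred0) (generic : nonint (2%:R * h)).
Implicit Types (g c : F) (p : {poly F}) (m : int) (k l n N : nat).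

Local Notation gp := (pochhammer h).

Lemma two_neq0 : 2%:R != 0 :> F.
Proof. exact: (natS_neq0 char0 1). Qed.

Lemma rbin_reflectz c m : rbin c m = (-1) ^+ odd `|m|%N * rbin (1 - m%:~R - c) m.
Proof.
case: m => k; last by rewrite !rbin_neg ?mulr0.
by rewrite signr_odd -rbin_reflect.
Qed.

(** Uses (h + m')_m = (h)_{m' + m} / (h)_{m'}, and serves to bring entries into the form of
    [kratt]. *)
Lemma rbin_gp m m' (x : F) : x = h + m'%:~R ->
  rbin x m = gp (m' + m) / gp m' * invfact F m.
Proof.
move=> ->; congr (_ * _); apply: (mulfI (g_neq0 generic m')).
rewrite mulrCA mulfV ?mulr1 ?g_neq0 //.
have hx : nonint (h + m'%:~R) by apply: nonintD; apply: half_generic.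
have step := pochhammer_step _ hx.
have gstep := @g_step _ _ generic _ _ erefl.
elim/int_rect: m => [|j IHj|j IHj].
- by rewrite pochhammer0 mulr1 addr0.
- rewrite -addn1 PoszD step mulrA IHj addrA gstep intrD addrA //.
- have x0 := hx (- j.+1%:Z).
  apply: (mulIf x0); rewrite -mulrA -step (_ : - j.+1%:Z + 1 = - j%:Z); last by lia.
  rewrite IHj (_ : m' - j%:Z = m' - j.+1%:Z + 1); last by lia.
  by rewrite gstep intrD addrA.
Qed.

Definition pairing g N p : F := Phi g N%:Z p + Psi (2%:R * h + g) N%:Z p.

(** Under X -> 1 - X these polynomials are symmetric for even [k] and antisymmetric for odd [k]. *)
Definition sym_basis k : {poly F} :=
  (if odd k then 'X - (2%:R^-1)%:P else 1) * ('X * ('X - 1)) ^+ k./2.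

(** Reflection matches [Phi] with [Psi] exactly at g = 1/2 - h - N/2. For odd N this is the g used;
    for even N the weights at g - 1/2 and g + 1/2 are averaged, so that -h is shifted by integers
    only. *)
Definition sym_cols j N : F :=
  if odd N then rbin (- h - N./2%:R) (N%:Z - j%:Z)
  else (rbin (- h - N./2%:R) (N%:Z - j%:Z) + rbin (1 - h - N./2%:R) (N%:Z - j%:Z)) / 2%:R.

Lemma pairing_even_row g N k :
  pairing g N (sym_basis k.*2) =
  (-1) ^+ odd k * rbin (g - k%:R) (N%:Z - k%:Z) + rbin (2%:R * h + g + 2%:R * k%:R) (N%:Z - k%:Z).
Proof.
rewrite /pairing /sym_basis odd_double doubleK Phi_mulXB1X // Psi_mulXB1X // signr_odd.
by rewrite /Phi /Psi !coef_pairing1 subr0 addr0.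
Qed.

Lemma pairing_odd_row g N k :
  pairing g N (sym_basis k.*2.+1) =
  ((-1) ^+ odd k * (rbin (g - k%:R) (N%:Z - k%:Z - 1) - rbin (g - k%:R - 1) (N%:Z - k%:Z))
  + rbin (2%:R * h + g + 2%:R * k%:R + 1) (N%:Z - k%:Z)
  + rbin (2%:R * h + g + 2%:R * k%:R + 1) (N%:Z - k%:Z - 1)) / 2%:R.
Proof.
rewrite /pairing /sym_basis /= odd_double uphalf_double Phi_mulXB1X // Psi_mulXB1X // signr_odd.
have -> : 'X - (2%:R^-1)%:P = 2%:R^-1 *: (1 * 'X + 1 * ('X - 1)) :> {poly F}.
  rewrite !mul1r addrA -mulr2n scalerBr -scaler_nat scalerA mulVf ?two_neq0 // scale1r.
  by rewrite alg_polyC.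
rewrite /Phi /Psi !coef_pairingZ !coef_pairingD.
rewrite -!/(Phi _ _ _) -!/(Psi _ _ _) !Phi_mulX !Psi_mulX !Phi_mulXB1 ?Psi_mulXB1 //.
by rewrite /Phi /Psi !coef_pairing1 !subr0 !addr0; ring.
Qed.

Lemma signK (b : bool) (x : F) : (-1) ^+ b * ((-1) ^+ b * x) = x.
Proof. by rewrite mulrA -expr2 sqrr_sign mul1r. Qed.

(** After reflection the [Phi] term of each column equals the [Psi] term of the other. The two
    distinct values left have a common factor [kratt], with cofactors h + 2k - l and h + l + k. The
    row index of [kratt] is the column index here. *)
Lemma sym_even_even k l :
  pairing (- h - l%:R) l.*2 (sym_basis k.*2) + pairing (1 - h - l%:R) l.*2 (sym_basis k.*2) =
  2%:R * ((2%:R * h + 3%:R * k%:R) * kratt h 0 0 l k).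
Proof.
rewrite !pairing_even_row.
rewrite (rbin_reflectz (- h - l%:R - k%:R)) (rbin_reflectz (1 - h - l%:R - k%:R)).
have -> : odd `|l.*2%:Z - k%:Z|%N = odd k by lia.
rewrite !signK -muln2 PoszM.
set M : int := l%:Z * 2 - k%:Z.
have r1 := @rbin_gp M (2 * k%:Z - l%:Z).
have r2 := @rbin_gp M (2 * k%:Z - l%:Z + 1).
rewrite (r2 (1 - M%:~R - (- h - l%:R - k%:R))); last by rewrite /M; ring.
rewrite (r1 (1 - M%:~R - (1 - h - l%:R - k%:R))); last by rewrite /M; ring.
rewrite (r1 (2%:R * h + (- h - l%:R) + 2%:R * k%:R)); last by ring.
rewrite (r2 (2%:R * h + (1 - h - l%:R) + 2%:R * k%:R)); last by ring.
rewrite /kratt (_ : 0 + 2 * l%:Z - k%:Z = M); last by rewrite /M; ring.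
rewrite (_ : 2 * k%:Z - l%:Z + M = 0 + 0 + l%:Z + k%:Z); last by rewrite /M; ring.
rewrite (_ : 2 * k%:Z - l%:Z + 1 + M = 0 + 0 + l%:Z + k%:Z + 1); last by rewrite /M; ring.
rewrite (_ : 0 + 2 * k%:Z - l%:Z + 1 = 2 * k%:Z - l%:Z + 1); last by ring.
rewrite !(g_step generic (erefl (_ + 1))).
have g0 := g_neq0 generic (2 * k%:Z - l%:Z).
have h0 : h + (2 * k%:Z - l%:Z)%:~R != 0 by apply: half_generic.
move: (gp _) (gp _) (invfact _ _) g0 h0 => g1 g2 i1 g0 h0.
field.
by rewrite g0 andbT; move: h0; rewrite (_ : (2 * k%:Z - l%:Z)%:~R = 2%:R * k%:R - l%:R) //; ring.
Qed.

(* rbin_reflectz turns the Phi terms of each of the two averaged columns into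
   minus the Psi terms of the other. *)
Lemma sym_odd_even k l :
  pairing (- h - l%:R) l.*2 (sym_basis k.*2.+1) +
  pairing (1 - h - l%:R) l.*2 (sym_basis k.*2.+1) = 0.
Proof.
rewrite !pairing_odd_row -mulrDl -[RHS](mul0r 2%:R^-1); congr (_ * _).
set M := l.*2%:Z - k%:Z; set s := (-1) ^+ odd k.
have sM : odd `|M|%N = odd k by rewrite /M; lia.
have sM1 : odd `|M - 1|%N = ~~ odd k by rewrite /M; lia.
rewrite (rbin_reflectz (- h - l%:R - k%:R) (M - 1)) (rbin_reflectz (- h - l%:R - k%:R - 1) M).
rewrite (rbin_reflectz (1 - h - l%:R - k%:R) (M - 1)) (rbin_reflectz (1 - h - l%:R - k%:R - 1) M).
rewrite sM sM1 signrN -/s !mulNr !mulrBr !mulrN !signK.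
have ME : M = 2 * l%:Z - k%:Z by rewrite /M; lia.
rewrite (_ : 1 - (M - 1)%:~R - (- h - l%:R - k%:R) = h - l%:R + 2%:R * k%:R + 2%:R); last first.
  by rewrite ME; ring.
rewrite (_ : 1 - M%:~R - (- h - l%:R - k%:R - 1) = h - l%:R + 2%:R * k%:R + 2%:R); last first.
  by rewrite ME; ring.
rewrite (_ : 1 - (M - 1)%:~R - (1 - h - l%:R - k%:R) = h - l%:R + 2%:R * k%:R + 1); last first.
  by rewrite ME; ring.
rewrite (_ : 1 - M%:~R - (1 - h - l%:R - k%:R - 1) = h - l%:R + 2%:R * k%:R + 1); last first.
  by rewrite ME; ring.
rewrite (_ : 2%:R * h + (- h - l%:R) + 2%:R * k%:R + 1 = h - l%:R + 2%:R * k%:R + 1); last by ring.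
rewrite (_ : 2%:R * h + (1 - h - l%:R) + 2%:R * k%:R + 1 = h - l%:R + 2%:R * k%:R + 2%:R); last by ring.
move: (rbin _ _) (rbin _ _) (rbin _ _) (rbin _ _) => a b c d; ring.
Qed.

(** At this g reflection turns the [Phi] term into minus the [Psi] term. *)
Lemma sym_even_odd k l : pairing (- h - l%:R) l.*2.+1 (sym_basis k.*2) = 0.
Proof.
rewrite pairing_even_row rbin_reflectz.
have -> : odd `|l.*2.+1%:Z - k%:Z|%N = ~~ odd k by lia.
rewrite signrN mulNr mulrN signK; apply/eqP; rewrite addrC subr_eq0; apply/eqP.
congr rbin; rewrite (_ : l.*2.+1%:Z = 2 * l%:Z + 1); last by lia.
ring.
Qed.

Lemma sym_odd_odd k l : pairing (- h - l%:R) l.*2.+1 (sym_basis k.*2.+1) =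
  (h + 3%:R * l%:R + 2%:R) * kratt h 1 0 l k.
Proof.
rewrite pairing_odd_row.
rewrite (rbin_reflectz (- h - l%:R - k%:R)) (rbin_reflectz (- h - l%:R - k%:R - 1)).
have -> : odd `|(l.*2.+1%:Z - k%:Z - 1)%R|%N = odd k by lia.
have -> : odd `|l.*2.+1%:Z - k%:Z|%N = ~~ odd k by lia.
rewrite mulrBr signrN !mulNr !mulrN opprK !signK (_ : l.*2.+1%:Z = l%:Z * 2 + 1); last by lia.
set M : int := l%:Z * 2 + 1 - k%:Z.
have rM := @rbin_gp M (2 * k%:Z - l%:Z + 1).
have rM1 := @rbin_gp (M - 1) (2 * k%:Z - l%:Z + 1).
rewrite (rM1 (1 - (M - 1)%:~R - (- h - l%:R - k%:R))); last by rewrite /M; ring.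
rewrite (rM (1 - M%:~R - (- h - l%:R - k%:R - 1))); last by rewrite /M; ring.
rewrite (rM (2%:R * h + (- h - l%:R) + 2%:R * k%:R + 1)); last by ring.
rewrite (rM1 (2%:R * h + (- h - l%:R) + 2%:R * k%:R + 1)); last by ring.
(* The terms with lower indices M and M - 1 now share [invfact M]; their cofactors h + 1 + l + k and
   M add up to h + 3l + 2. *)
rewrite (@invfact_stepE _ char0 (M - 1) M); last by rewrite subrK.
rewrite /kratt (_ : 1 + 2 * l%:Z - k%:Z = M); last by rewrite /M; ring.
rewrite (_ : 2 * k%:Z - l%:Z + 1 + (M - 1) = 1 + 0 + l%:Z + k%:Z); last by rewrite /M; ring.
rewrite (_ : 2 * k%:Z - l%:Z + 1 + M = 1 + 0 + l%:Z + k%:Z + 1); last by rewrite /M; ring.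
rewrite (_ : 0 + 2 * k%:Z - l%:Z + 1 = 2 * k%:Z - l%:Z + 1); last by ring.
rewrite (g_step generic (erefl (1 + 0 + l%:Z + k%:Z + 1))) /M.
have g0 := g_neq0 generic (2 * k%:Z - l%:Z + 1).
move: (gp _) (gp _) (invfact _ _) g0 => g1 g2 i1 g0.
field.
by rewrite g0 two_neq0.
Qed.

Lemma sym_basis_size_monic k : size (sym_basis k) = k.+1 /\ sym_basis k \is monic.
Proof.
have XB1_monic : ('X - 1 : {poly F}) \is monic by rewrite -[1]/(1%:P) monicXsubC.
have q_monic : 'X * ('X - 1) \is @monic F by rewrite monicMl ?monicX.
have size_q : size ('X * ('X - 1) : {poly F}) = 3%N.
  by rewrite size_Mmonic ?polyX_eq0 // size_polyX -polyC1 size_XsubC.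
have size_qn n : size (('X * ('X - 1) : {poly F}) ^+ n) = n.*2.+1.
  have := size_exp ('X * ('X - 1) : {poly F}) n; rewrite size_q /= mul2n => <-.
  by rewrite prednK // lt0n size_poly_eq0 monic_neq0 ?monic_exp.
have qn_monic n : ('X * ('X - 1) : {poly F}) ^+ n \is monic by rewrite monic_exp.
rewrite /sym_basis; case odd_k: (odd k); last first.
  by rewrite !mul1r size_qn -[in k.+1](odd_double_half k) odd_k.
rewrite monicMl ?monicXsubC //; split=> //.
by rewrite size_Mmonic ?polyXsubC_eq0 // size_XsubC size_qn -[in k.+1](odd_double_half k) odd_k.
Qed.

Lemma coef_pairing_sym_cols n k l : (l < n)%N ->
  coef_pairing (fun i => \sum_(j < n) delta_binom (2%:R * h) 0 i j * sym_cols j l) (sym_basis k) =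
  if odd l then pairing (- h - l./2%:R) l (sym_basis k)
  else (pairing (- h - l./2%:R) l (sym_basis k)
        + pairing (1 - h - l./2%:R) l (sym_basis k)) / 2%:R.
Proof.
move=> lt_ln.
have pairingE g p : pairing g l p = coef_pairing (fun i =>
    \sum_(j < n) delta_binom (2%:R * h) 0 i j * rbin g (l%:Z - j%:Z)) p.
  by rewrite coef_pairing_delta_binom // /pairing subr0 addr0.
rewrite /sym_cols; case: ifP => _; first by rewrite pairingE.
rewrite !pairingE /coef_pairing -big_split mulr_suml; apply: eq_bigr => i _ /=.
rewrite -mulrDr -mulrA -big_split mulr_suml /=; congr (_ * _).
by apply: eq_bigr => j _; ring.
Qed.

Lemma window_det_delta_binom (c n : nat) : (c <= 1)%N ->
  window_det (n + c + n) (delta_binom (2%:R * h) 0) =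
  \prod_(k < n + c) (2%:R * h + 3%:R * k%:R) * kratt_prod h (n + c) 0 0
  * (\prod_(k < n) (h + 3%:R * k%:R + 2%:R) * kratt_prod h n 1 0).
Proof.
move=> c_le1.
rewrite (@window_det_pairing _ _ _ sym_basis sym_cols); first last.
- move=> j k lt_kj; rewrite /sym_cols !rbin_neg ?addr0 ?mul0r ?if_same //; lia.
- move=> k; rewrite /sym_cols subrr !rbin0 -mulr2n divff ?if_same //; exact: two_neq0.
- by move=> k; case: (sym_basis_size_monic k).
- by move=> k; case: (sym_basis_size_monic k).
pose W k l := if odd l then pairing (- h - l./2%:R) l (sym_basis k)
  else (pairing (- h - l./2%:R) l (sym_basis k)
        + pairing (1 - h - l./2%:R) l (sym_basis k)) / 2%:R.
rewrite (@eq_window_det _ _ _ W); last by move=> k l _ lt_l; rewrite coef_pairing_sym_cols.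
rewrite window_det_checkerboard //; last first.
  move=> k l; rewrite /W; move: (odd_double_half k) (odd_double_half l).
  case: (odd k); case: (odd l) => //; move: k./2 l./2 => k' l' <- <- _; rewrite ?add1n ?add0n.
    by rewrite sym_odd_even mul0r.
  by rewrite sym_even_odd.
congr (_ * _).
  rewrite -(kratt_det char0 generic) // -[window_det _ (kratt _ _ _)]window_det_tr.
  rewrite -(window_det_scale_rows _ (fun k => 2%:R * h + 3%:R * k%:R)).
  apply: eq_window_det => k l _ _; rewrite /W odd_double doubleK sym_even_even mulrC mulKf //.
  exact: two_neq0.
rewrite -(kratt_det char0 generic) // -[LHS]window_det_tr.
rewrite -(window_det_scale_rows _ (fun k => h + 3%:R * k%:R + 2%:R)).
by apply: eq_window_det => l k _ _; rewrite /W /= odd_double uphalf_double sym_odd_odd.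
Qed.

End Andrews.

(** * Ratios of consecutive determinants in closed form *)

Section Ratios.

Variables (F : fieldType) (h : F).
Hypotheses (char0 : [pchar F] =i pred0) (generic : nonint (2%:R * h)).
Implicit Types (m n k : nat).

Definition andrews_det n : F := window_det n (delta_binom (2%:R * h) 0).

Lemma andrews_det_neq0 n : andrews_det n != 0.
Proof.
rewrite /andrews_det -(odd_double_half n) (_ : odd n + n./2.*2 = n./2 + odd n + n./2)%N; last by lia.
rewrite window_det_delta_binom ?leq_b1 // !mulf_neq0 ?kratt_prod_neq0 //; apply/prodf_neq0 => k _.
  rewrite (_ : _ + _ = 2%:R * h + (3 * k%:Z)%:~R) //; ring.
by apply: (@generic_neq0 _ _ generic (3 * k%:Z + 2)); ring.
Qed.

Lemma andrews_det1 : andrews_det 1 = 2%:R.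
Proof.
rewrite /andrews_det (@window_det_delta_binom _ h char0 generic 1 0) // !big_ord1 /kratt_prod.
rewrite big_ord1 !big_ord0 /kratt_factor mulr0 !addr0 add0r !pochhammer0 /= big_ord1 addr0 invr1 fact0.
have h0 : h != 0 by apply: (@generic_neq0 _ _ generic 0); ring.
by field.
Qed.

Lemma andrews_det_odd m :
  andrews_det m.*2.+1 = andrews_det m.*2 * ((2%:R * h + 3%:R * m%:R) * kratt_factor h 0 0 m).
Proof.
have := @window_det_delta_binom _ h char0 generic 1 m isT.
have := @window_det_delta_binom _ h char0 generic 0 m isT.
rewrite addn0 addn1 addSn addnn /andrews_det => -> ->.
by rewrite /kratt_prod !big_ord_recr /=; ring.
Qed.

Lemma andrews_det_even m :
  andrews_det m.*2.+2 =
  andrews_det m.*2.+1 * ((h + 3%:R * m%:R + 2%:R) * kratt_factor h 1 0 m).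
Proof.
have := @window_det_delta_binom _ h char0 generic 0 m.+1 isT.
have := @window_det_delta_binom _ h char0 generic 1 m isT.
rewrite addn0 addn1 addSn addnS !addSn addnn /andrews_det => -> ->.
by rewrite /kratt_prod !(big_ord_recr m) /=; ring.
Qed.

Lemma fact_pochhammer k n : k`!%:R * pochhammer (k.+1%:R : F) n%:Z = (k + n)`!%:R.
Proof.
elim: n => [|n IHn]; first by rewrite pochhammer0 mulr1 addn0.
by rewrite pochhammerSr mulrA IHn addnS factS natrM mulrC -addSn natrD.
Qed.

(** Writing m = k + 1 gives the symbols of length m - 1 a natural length. The case m = 0 is the
    initial value [andrews_det1]. *)
Lemma andrews_ratio_even k (m := k.+1) :
  (2%:R * h + 3%:R * m%:R) * kratt_factor h 0 0 m =
  pochhammer (2%:R * h + 2%:R * m%:R + 1) m%:Z * pochhammer (h + 2%:R * m%:R + 1) k%:Z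
  / (pochhammer m%:R m%:Z * pochhammer (h + m%:R + 1) k%:Z).
Proof.
have hp (b : F) (n : nat) a : b = h + a%:~R -> pochhammer b n%:Z != 0.
  by move=> ->; apply/pochhammer_neq0/nonintD; apply: half_generic.
rewrite /kratt_factor mulr0 !add0r addr0.
(* The linear factor extends the symbol based at 2h + 2m to length m + 1, whose first factor is then
   split off. *)
have e1 : pochhammer (2%:R * h + 2%:R * m%:R) m%:Z * (2%:R * h + 3%:R * m%:R) =
   (2%:R * h + 2%:R * m%:R) * pochhammer (2%:R * h + 2%:R * m%:R + 1) m%:Z.
  by rewrite -pochhammerSl pochhammerSr; congr (_ * _); ring.
have e2 : pochhammer h (2 * m%:Z + 1) = pochhammer h m%:Z * ((h + m%:R)
    * (pochhammer (h + m%:R + 1) k%:Z * (h + 2%:R * m%:R))).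
  rewrite (_ : 2 * m%:Z + 1 = (m + k.+2)%N%:Z); last by rewrite /m; lia.
  rewrite pochhammerD pochhammerSl pochhammerSr; do 3!congr (_ * _); rewrite /m -natr1; ring.
have e3 : invfact F (2 * m%:Z) = (2%:R * m%:R * (k`!%:R * pochhammer m%:R m%:Z))^-1.
  rewrite fact_pochhammer (_ : 2 * m%:Z = ((k + m).+1)%N%:Z); last by rewrite /m; lia.
  rewrite /invfact factS natrM; congr ((_ * _)^-1); rewrite -natrM; congr _%:R; rewrite /m; lia.
have e4 : pochhammer (h + 2%:R * m%:R) m%:Z =
    (h + 2%:R * m%:R) * pochhammer (h + 2%:R * m%:R + 1) k%:Z by rewrite pochhammerSl.
rewrite e2 e3 e4.
have e5 : m`!%:R = m%:R * k`!%:R :> F by rewrite /m factS natrM.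
have m0 : m%:R != 0 :> F by apply: natS_neq0.
have p0 : pochhammer (m%:R : F) m%:Z != 0.
  have : (k + m)`!%:R != 0 :> F by apply: fact_neq0.
  by rewrite -fact_pochhammer mulf_eq0 negb_or => /andP[].
have p1 := hp (h + m%:R + 1) k (m%:Z + 1) ltac:(by ring).
have h1 : h + m%:R != 0 by apply: (@generic_neq0 _ _ generic m%:Z); ring.
have h2 : h + 2%:R * m%:R != 0 by apply: (@generic_neq0 _ _ generic (2 * m%:Z)); ring.
have g0 := g_neq0 generic m%:Z.
have k0 := fact_neq0 char0 k.
have t0 := two_neq0 char0.
have swap (x a b c d u v : F) : x * (a * b * c * d / u / v) = d * x * (a * b * c / u / v) by ring.
rewrite swap e1 e5; move: p0 p1 g0.
move: (pochhammer _ _) (pochhammer _ _) (pochhammer _ _) => P1 P2 P3.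
move: (pochhammer _ _) (pochhammer _ _) => P4 P5 p0 p1 g0.
field.
by rewrite p0 p1 g0 h1 h2 k0 m0 t0.
Qed.

Lemma andrews_ratio_odd m :
  (h + 3%:R * m%:R + 2%:R) * kratt_factor h 1 0 m =
  pochhammer (2%:R * h + 2%:R * m%:R + 1) m%:Z * pochhammer (h + 2%:R * m%:R + 2%:R) m.+1%:Z
  / (pochhammer m.+1%:R m.+1%:Z * pochhammer (h + m%:R + 1) m%:Z).
Proof.
have hp (b : F) (n : nat) a : b = h + a%:~R -> pochhammer b n%:Z != 0.
  by move=> ->; apply/pochhammer_neq0/nonintD; apply: half_generic.
rewrite /kratt_factor.
rewrite (_ : 2%:R * 1%:~R + (h + 0%:~R) + 2%:R * m%:R = h + 2%:R * m%:R + 2%:R); last by ring.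
rewrite (_ : 1%:~R + 2%:R * (h + 0%:~R) + 2%:R * m%:R = 2%:R * h + 2%:R * m%:R + 1); last by ring.
rewrite pochhammerSr.
have e2 : pochhammer h (0 + 2 * m%:Z + 1) =
    pochhammer h (1 + 0 + m%:Z) * pochhammer (h + m%:R + 1) m%:Z.
  rewrite (_ : 0 + 2 * m%:Z + 1 = (m.+1 + m)%N%:Z); last by lia.
  rewrite (_ : 1 + 0 + m%:Z = m.+1%:Z); last by lia.
  by rewrite pochhammerD -natr1 addrA.
have e3 : invfact F (1 + 2 * m%:Z) = (m`!%:R * pochhammer m.+1%:R m.+1%:Z)^-1.
  by rewrite fact_pochhammer (_ : 1 + 2 * m%:Z = ((m + m.+1)%N%:Z)) //; lia.
have p0 : pochhammer (m.+1%:R : F) m.+1%:Z != 0.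
  have : (m + m.+1)`!%:R != 0 :> F by apply: fact_neq0.
  by rewrite -fact_pochhammer mulf_eq0 negb_or => /andP[].
have p1 := hp (h + m%:R + 1) m (m%:Z + 1) ltac:(by ring).
have g0 := g_neq0 generic (1 + 0 + m%:Z).
have m0 := fact_neq0 char0 m.
rewrite e2 e3; move: p0 p1 g0.
move: (pochhammer _ _) (pochhammer _ _) (pochhammer _ _) => P1 P2 P3.
move: (pochhammer _ _) (pochhammer _ _) => P4 P5 p0 p1 g0.
field.
by rewrite p0 p1 g0 m0.
Qed.

End Ratios.

(** * Specialization to Q(mu) and the final induction *)

Lemma binom_rbin (F : fieldType) (x : F) (j : nat) :
  binom x j%:Z = rbin (x - j%:R + 1) j%:Z.
Proof.
rewrite /rbin /=; congr (_ / _).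
rewrite (reindex_inj rev_ord_inj) /=; apply: eq_bigr => i _.
by rewrite natrB // -natr1; ring.
Qed.

Lemma D_window_det (s n : nat) : D s%:Z 0 n = window_det n (delta_binom (mu - 1) s).
Proof.
congr determinant; apply/matrixP => i j; rewrite !mxE /delta_binom add0r binom_rbin.
congr (_%:R + rbin _ _); rewrite natrD intrD -!pmulrn; ring.
Qed.

Lemma Qmu_char0 : [pchar Qmu] =i pred0.
Proof.
apply/pcharf0P => n; rewrite -(rmorph_nat (@tofrac {poly rat})) tofrac_eq0.
by rewrite -polyC_natr polyC_eq0 pnatr_eq0.
Qed.

Lemma mu_nonint : nonint mu.
Proof.
move=> m; rewrite -(rmorph_int (@tofrac {poly rat})) -rmorphD tofrac_eq0.
have -> : 'X + m%:~R = 'X - (- m%:~R)%:P :> {poly rat} by rewrite polyCN opprK rmorph_int.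
by rewrite polyXsubC_eq0.
Qed.

(** The [h] for which 2h = nu + 3s, with nu = mu - 1 and s = 2r. *)
Definition half_shift (r : nat) : Qmu := (mu - 1) / 2%:R + (3 * r)%:R.

Lemma double_half_shift r : 2%:R * half_shift r = mu + ((6 * r)%N%:Z - 1)%:~R.
Proof.
have t0 := two_neq0 Qmu_char0.
rewrite /half_shift mulrDr mulrC divfK // intrB -pmulrn -natrM mulnA -addrA.
by rewrite [- 1 + _]addrC.
Qed.

Lemma half_shift_generic r : nonint (2%:R * half_shift r).
Proof. by rewrite double_half_shift; apply: nonintD; apply: mu_nonint. Qed.

Lemma D_andrews_det (r m : nat) :
  D (2 * r)%:Z 0 (2 * r + m) = andrews_det (half_shift r) m.
Proof.
have even_2r : ~~ odd (2 * r) by rewrite mul2n odd_double.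
have nuE : mu - 1 + (3 * (2 * r))%:R = 2%:R * half_shift r.
  by rewrite double_half_shift intrB -pmulrn mulnA -addrA [- 1 + _]addrC.
by rewrite D_window_det (window_det_delta_binom_shift _ _ Qmu_char0 even_2r) nuE.
Qed.

Lemma mu_half_shift r : mu = 2%:R * half_shift r + 1 - (6 * r)%:R.
Proof. by rewrite double_half_shift intrB -pmulrn; ring. Qed.

Lemma mu2_half_shift r : mu / 2%:R = half_shift r + 2%:R^-1 - (3 * r)%:R.
Proof. by rewrite /half_shift; ring. Qed.

Lemma half_sum : 2%:R^-1 + 2%:R^-1 = 1 :> Qmu.
Proof. by field; apply: (two_neq0 Qmu_char0). Qed.

Lemma R_odd_ratio r m :
  R_odd r (r + m.+1) = (half_shift r + 3%:R * m%:R + 2%:R) * kratt_factor (half_shift r) 1 0 m.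
Proof.
rewrite (andrews_ratio_odd Qmu_char0 (@half_shift_generic r)) /R_odd.
rewrite (mu2_half_shift r) [mu](mu_half_shift r); set h := half_shift r.
rewrite (_ : (r + m.+1)%N%:Z - r%:Z = m.+1%:Z); last by lia.
rewrite (_ : m.+1%:Z - 1 = m%:Z); last by lia.
congr (pochhammer _ _ * pochhammer _ _ / (pochhammer _ _ * pochhammer _ _)).
- ring.
- ring.
- ring.
- ring.
Qed.

Lemma R_even_ratio r k (m := k.+1) :
  R_even r (r + m) = (2%:R * half_shift r + 3%:R * m%:R) * kratt_factor (half_shift r) 0 0 m.
Proof.
rewrite /m (andrews_ratio_even Qmu_char0 (@half_shift_generic r)) /R_even.
rewrite (mu2_half_shift r) [mu](mu_half_shift r); set h := half_shift r.
rewrite (_ : (r + k.+1)%N%:Z - r%:Z = k.+1%:Z); last by lia.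
rewrite (_ : k.+1%:Z - 1 = k%:Z); last by lia.
congr (pochhammer _ _ * pochhammer _ _ / (pochhammer _ _ * pochhammer _ _)).
- ring.
- rewrite -[X in _ = _ + X]half_sum; ring.
- ring.
- rewrite -[X in _ = _ + X]half_sum; ring.
Qed.

Lemma D_neq0 r n : (2 * r <= n)%N -> D (2 * r)%:Z 0 n != 0.
Proof.
move=> /subnKC <-; rewrite D_andrews_det; exact: (andrews_det_neq0 Qmu_char0 (@half_shift_generic r)).
Qed.

Lemma D_step r n : (2 * r < n)%N -> D (2 * r)%:Z 0 n.+1 = D (2 * r)%:Z 0 n * R r n.
Proof.
move=> lt_rn; rewrite -{1 2}(subnKC (ltnW lt_rn)) -addnS !D_andrews_det.
have gen := @half_shift_generic r; have char0 := Qmu_char0.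
(* As 2r is even, n and n - 2r have the same parity. In both cases the argument p of [R_odd] or
   [R_even] is r + m + 1. *)
have [m [n_odd|n_even]] : exists m, n = (2 * r + m.*2.+1)%N \/ n = (2 * r + m.+1.*2)%N.
  by exists (n - 2 * r).-1./2; lia.
- rewrite n_odd addKn andrews_det_even //; congr (_ * _); rewrite /R.
  rewrite (_ : odd _ = true); last by lia.
  by rewrite -R_odd_ratio; congr R_odd; lia.
- rewrite n_even addKn andrews_det_odd //; congr (_ * _); rewrite /R.
  rewrite (_ : odd _ = false); last by lia.
  by rewrite -R_even_ratio; congr R_even; lia.
Qed.

Theorem theorem18 (r : nat) :
  (forall n : nat, (2 * r < n)%N ->
     D (2 * r)%:Z 0 n = 2%:R * \prod_((2 * r).+1 <= i < n) R r i)
  /\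
  (forall m : nat, (2 * r < m)%N ->
     D (2 * r)%:Z 0 m != 0
     /\ R r m = D (2 * r)%:Z 0 m.+1 / D (2 * r)%:Z 0 m).
Proof.
split=> [n|m lt_rm]; last first.
  have Dm0 := D_neq0 (ltnW lt_rm); split=> //.
  by rewrite D_step // mulrC mulKf.
elim: n => // n IHn; rewrite ltnS leq_eqVlt => /orP[/eqP <-|lt_rn].
  (* For n = 2r + 1 the product is empty, and the reduced 1 x 1 determinant supplies the factor
     2. *)
  rewrite big_geq // mulr1 -(addn1 (2 * r)) D_andrews_det andrews_det1 //; first exact: Qmu_char0.
  exact: half_shift_generic.
by rewrite D_step // IHn // big_nat_recr // mulrA.
Qed.
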